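(* Let $f:\mathbb{R}^{2}\to\mathbb{R}$ be a continuous map whose graph $G(f)$ is a saddle surface with center at the origin. Then for any square table $S$ (that is, for any side length $r>0$), one can place $S$ horizontally on the surface $G(f)$, with its center at the origin and with its sides parallel to the coordinate axes; that is, $f$ takes the same value at the four vertices of the square in $\mathbb{R}^2$ of side length $r$ centered at the origin with sides parallel to the coordinate axes.
   Context: For continuous $f:\mathbb{R}^2\to\mathbb{R}$, the graph is $G(f)=\{(x,f(x))\in\mathbb{R}^3:x\in\mathbb{R}^2\}$. The graph $G(f)$ is called a saddle surface with center $p=(p_1,p_2)$ if $f$ satisfies, for all real $x_1,\bar x_1,x_2,\bar x_2$: (i) $f(x_{1},x_{2})>f(\bar{x}_{1},x_{2})$ whenever $|x_{1}-p_{1}|>|\bar{x}_{1}-p_{1}|$; (ii) $f(x_{1},x_{2})<f(x_{1},\bar{x}_{2})$ whenever $|x_{2}-p_{2}|>|\bar{x}_{2}-p_{2}|$. A square table of side length $r$ is placed horizontally on $G(f)$ at a square $a_1a_2a_3a_4\subset\mathbb{R}^2$ of side length $r$ if $f(a_1)=f(a_2)=f(a_3)=f(a_4)$, i.e. the four points $(a_i,f(a_i))$ lie in a horizontal plane. *)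

(* Defs.v *)
From HB Require Import structures.
From mathcomp Require Import all_boot all_order all_algebra.
From mathcomp Require Import all_classical all_reals all_analysis.

Set Implicit Arguments.
Unset Strict Implicit.
Unset Printing Implicit Defensive.

Import Order.TTheory GRing.Theory Num.Theory.
Import numFieldNormedType.Exports.

Local Open Scope ring_scope.

(* The saddle conditions on [f], i.e. on its graph; continuity of [f] is a
   separate hypothesis. *)
Definition saddle_surface (R : realType) (f : R * R -> R) (p : R * R) : Prop :=
  (forall x1 y1 x2 : R,
     `|x1 - p.1| > `|y1 - p.1| -> f (x1, x2) > f (y1, x2)) /\
  (forall x1 x2 y2 : R,
     `|x2 - p.2| > `|y2 - p.2| -> f (x1, x2) < f (x1, y2)).

Definition dotp (R : realType) (u v : R * R) : R := u.1 * v.1 + u.2 * v.2.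

(* The library norm on [R * R] is the sup norm, hence this definition. *)
Definition enorm (R : realType) (u : R * R) : R := Num.sqrt (dotp u u).

(* Vertices are listed in cyclic order. *)
Definition is_square (R : realType) (r : R) (a1 a2 a3 a4 : R * R) : Prop :=
  [/\ a2 - a1 = a3 - a4,
      dotp (a2 - a1) (a4 - a1) = 0,
      enorm (a2 - a1) = r
    & enorm (a4 - a1) = r].

Definition square_center (R : realType) (a1 a2 a3 a4 : R * R) : R * R :=
  ((a1.1 + a2.1 + a3.1 + a4.1) / 4, (a1.2 + a2.2 + a3.2 + a4.2) / 4).

Definition axis_parallel (R : realType) (a b : R * R) : Prop :=
  a.1 = b.1 \/ a.2 = b.2.

Definition sides_axis_parallel (R : realType) (a1 a2 a3 a4 : R * R) : Prop :=
  [/\ axis_parallel a1 a2, axis_parallel a2 a3,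
      axis_parallel a3 a4 & axis_parallel a4 a1].

Definition placed_horizontally (R : realType) (f : R * R -> R) (r : R)
    (a1 a2 a3 a4 : R * R) : Prop :=
  is_square r a1 a2 a3 a4 /\ [/\ f a1 = f a2, f a2 = f a3 & f a3 = f a4].

(* Main.v *)
Require Import Defs.
From HB Require Import structures.
From mathcomp Require Import all_boot all_order all_algebra.
From mathcomp Require Import all_classical all_reals all_analysis.
From mathcomp Require Import ring.

Import Order.TTheory GRing.Theory Num.Theory.
Import numFieldNormedType.Exports.

Local Open Scope classical_set_scope.
Local Open Scope ring_scope.

(** On each line parallel to an axis, [f] or [- f] is strictly increasing in
    the absolute value of the free coordinate. The saddle conditions do not
    compare the values at [x] and [- x], but a continuous function of one
    variable that increases with the absolute value is even
    ([even_of_abs_increasing]). So [f] is even in each coordinate separately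
    ([saddle_even_fst], [saddle_even_snd]), and the four points
    [(+- r/2, +- r/2)], which are exchanged by sign changes of the
    coordinates, have the same height. *)

(** The value at [- x] is below the values at the points just beyond [x],
    hence, by continuity, at most the value at [x]; exchanging [x] and [- x]
    gives the other inequality. *)
Lemma even_of_abs_increasing (R : realType) (g : R -> R) :
  continuous g -> (forall x y, `|y| < `|x| -> g y < g x) ->
  forall x, g (- x) = g x.
Proof.
move=> g_cont g_incr.
suff le_g x : g (- x) <= g x.
  by move=> x; apply/le_anti; rewrite le_g -{1}[x]opprK le_g.
have [->|x_neq0] := eqVneq x 0; first by rewrite oppr0.
(* Approach [x] from outside along [e * x] with [e] decreasing to 1; this
   treats both signs of [x] at once. *)
have cvg_x : e * x @[e --> 1^'+] --> x.
  apply: cvg_at_right_filter.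
  by have /cvg_trans := @mulrr_continuous R x 1; rewrite mul1r; apply.
apply: (cvgr_to_ge (cvg_comp _ _ cvg_x (g_cont x))).
near=> e.
apply/ltW/g_incr.
have e_gt1 : 1 < e by near: e; exact: nbhs_right_gt.
rewrite normrN normrM (gtr0_norm (lt_trans ltr01 e_gt1)).
by rewrite ltr_pMl // normr_gt0.
Unshelve. all: by end_near. Qed.

Lemma saddle_even_fst (R : realType) (f : R * R -> R) :
  continuous f -> saddle_surface f (0, 0) ->
  forall x y, f (- x, y) = f (x, y).
Proof.
move=> f_cont [f_incr _] x y.
apply: (@even_of_abs_increasing _ (fun s => f (s, y))) => [s|s t lt_ts].
  apply: (@continuous_comp _ _ _ (fun s => (s, y)) f); last exact: f_cont.
  exact: (cvg_pair cvg_id (cvg_cst _)).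
by apply: f_incr; rewrite /= !subr0.
Qed.

Lemma saddle_even_snd (R : realType) (f : R * R -> R) :
  continuous f -> saddle_surface f (0, 0) ->
  forall x y, f (x, - y) = f (x, y).
Proof.
move=> f_cont [_ f_decr] x y; apply: oppr_inj.
apply: (@even_of_abs_increasing _ (fun s => - f (x, s))) => [s|s t lt_ts].
  apply: cvgN.
  apply: (@continuous_comp _ _ _ (fun s => (x, s)) f); last exact: f_cont.
  exact: (cvg_pair (cvg_cst _) cvg_id).
by rewrite ltrN2; apply: f_decr; rewrite /= !subr0.
Qed.

Theorem theorem4p5 (R : realType) (f : R * R -> R)
    (f_cont : continuous f) (f_saddle : saddle_surface f (0, 0))
    (r : R) (r_gt0 : 0 < r) :
  exists a1 a2 a3 a4 : R * R,
    [/\ placed_horizontally f r a1 a2 a3 a4,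
        square_center a1 a2 a3 a4 = (0, 0)
      & sides_axis_parallel a1 a2 a3 a4].
Proof.
have even1 := saddle_even_fst _ _ f_cont f_saddle.
have even2 := saddle_even_snd _ _ f_cont f_saddle.
pose h := r / 2.
have hhr : h + h = r by rewrite /h; field.
exists (- h, - h), (h, - h), (h, h), (- h, h); split.
- split; last by rewrite !even1 !even2.
  split; rewrite /enorm /dotp /=.
  + by congr (_, _); rewrite /= ?subrr.
  + by ring.
  + by rewrite opprK hhr addNr mul0r addr0 -expr2 sqrtr_sqr gtr0_norm.
  + by rewrite opprK hhr addNr mul0r add0r -expr2 sqrtr_sqr gtr0_norm.
- by rewrite /square_center /=; congr (_, _); field.
- by split; rewrite /axis_parallel /=; [right|left|right|left].
Qed.
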